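(* There exists a family of 3D quantum $X$-self-orthogonal CSS codes with the local geometry of rotated surface codes, in which the logical $S$ gate is realized transversally, and with parameters $$\Big[\!\Big[\tfrac{d(d+1)(d+2)}{3}-1,\;1,\;d\Big]\!\Big]$$ for odd $d\ge 1$. Moreover, when $d\ge 3$, the set $C$ of all $X$-stabilizers of the code can be decomposed as $C=C_e\oplus\mathrm{Span}(\{v\})$, where $C_e$ contains vectors of weights divisible by four and $\mathrm{wt}(v)\equiv 2\pmod 4$.
   Context: CSS codes: for binary linear codes $C_2\subseteq C_1\subseteq\mathbb{F}_2^n$ with $\dim C_1-\dim C_2=k'$, the CSS code of $C_2\subseteq C_1$ is the $n$-qubit stabilizer code whose $X$-stabilizers are the $X^{c}$, $c\in C_2$, and whose $Z$-stabilizers are the $Z^{c}$, $c\in C_1^\perp$ (Euclidean dual). Its parameters are $[\![n,k',d]\!]$ with $d=\min\{d_x,d_z\}$, where $d_x$ is the minimum Hamming weight of $C_1\setminus C_2$ and $d_z$ that of $C_2^\perp\setminus C_1^\perp$. Elements of $C_2$ and $C_1^\perp$ are identified with the $X$- and $Z$-stabilizers; logical $X$- and $Z$-operators are the elements of $C_1\setminus C_2$ and $C_2^\perp\setminus C_1^\perp$. When $k'=1$ and $u\in C_1\setminus C_2$, the logical basis states are, up to normalization, $|0\rangle_L=\sum_{c\in C_2}|c\rangle$, $|1\rangle_L=\sum_{c\in C_2}|c+u\rangle$. The code is $X$-self-orthogonal if its $X$-stabilizers form a self-orthogonal binary code, $C_2\subseteq C_2^\perp$ (it is not required that $C_1=C_2^\perp$).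 $S=\mathrm{diag}(1,i)$; the logical $S$ is realized transversally if some tensor product of single-qubit gates on the data qubits preserves the code space and acts, up to global phase, as $|0\rangle_L\mapsto|0\rangle_L$, $|1\rangle_L\mapsto i|1\rangle_L$. ''3D'' is an informal description of the layout: the data qubits are arranged in planar layers stacked vertically, with a single qubit (the distance-1 surface code) at the bottom and then, going up, two copies of the rotated surface code of each odd distance $3,5,\ldots,d$. Between the two copies of equal distance there is one $X$-check for each $X$-check of that surface code, acting on both copies; and between consecutive groups there is one connecting $X$-check, acting on all qubits of the lower copy of the larger distance and on the top layer of the group below. Local geometry: a CSS code $Q$ (of $C_2\subseteq C_1$) has a local geometry of a CSS code $Q'$ (of $C_2'\subseteq C_1'$) if there is a subset $A$ of the data qubits of $Q$ (identified with the data qubits of $Q'$) such that (puncturing rule) restricting the $X$-stabilizers and $X$-logical operators of $Q$ to $A$ gives the $X$-stabilizers and $X$-logical operators of $Q'$, i.e. $C_2|_A=C_2'$ and $C_1|_A=C_1'$; and (shortening rule) the $Z$-stabilizers and $Z$-logical operators of $Q$ supported inside $A$ give those of $Q'$, i.e. $\{z\in C_1^\perp:\mathrm{supp}\,z\subseteq A\}$ and $\{z\in C_2^\perp:\mathrm{supp}\,z\subseteq A\}$, restricted to $A$, are $C_1'^\perp$ and $C_2'^\perp$. ''With the local geometry of rotated surface codes'' means having a local geometry of a rotated surface code; for the distance-$d$ member of the family, the construction uses the rotated surface code of distance $d$ (the top layer). Rotated surface code of odd distance $d\ge 3$: the $[\![d^2,1,d]\!]$ CSS code with qubits at the points $(x,y)$,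 $0\le x,y\le d-1$. For integers $a,b$ let $P_{a,b}=\{a,a+1\}\times\{b,b+1\}$ intersected with the grid. The $X$-stabilizer generators are supported on $P_{a,b}$ with $a+b$ odd, $0\le a\le d-2$, $-1\le b\le d-1$; the $Z$-stabilizer generators are supported on $P_{a,b}$ with $a+b$ even, $-1\le a\le d-1$, $0\le b\le d-2$. The all-ones vector is a logical $X$-operator. For $d=1$ it is the $[\![1,1,1]\!]$ code with no stabilizers ($C_2=\{0\}$, $C_1=\mathbb{F}_2$). *)

(* Defs.v *)
From HB Require Import structures.
From mathcomp Require Import all_boot all_order all_algebra.
From mathcomp Require Import reals complex.
From mathcomp Require Import ring zify.

Set Implicit Arguments.
Unset Strict Implicit.
Unset Printing Implicit Defensive.

Import Order.TTheory GRing.Theory Num.Theory.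
Local Open Scope ring_scope.

(* F_2 as a one-dimensional space over itself; without ^o the function space
   {ffun Q -> 'F_2} has no inferred vector space structure. *)
Notation bit := (('F_2)^o)%type.

(* F_2^n, with the n coordinates labelled by the finite type Q. *)
Notation bvec Q := {ffun Q -> bit}.

Section Codes.
Variable Q : finType.

Definition supp (x : bvec Q) : {set Q} := [set q | x q != 0].
Definition wt (x : bvec Q) : nat := #|supp x|.
Definition indicator (P : pred Q) : bvec Q := [ffun q => (P q)%:R].
Definition dot (x y : bvec Q) : bit := \sum_q x q * y q.

Definition annihilator (C : {vspace bvec Q}) : {set bvec Q} :=
  [set x : bvec Q | [forall c : bvec Q, (c \in C) ==> (dot x c == 0)]].

(* The Euclidean dual; dualP below shows that taking the span adds nothing. *)
Definition dual (C : {vspace bvec Q}) : {vspace bvec Q} :=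
  <<enum (annihilator C)>>%VS.

Definition self_orthogonal (C : {vspace bvec Q}) := (C <= dual C)%VS.

Definition is_min_weight (P : pred (bvec Q)) (w : nat) :=
  (exists2 x, P x & wt x = w) /\ (forall x, P x -> (w <= wt x)%N).

Record css_code := CSS {
  C1 : {vspace bvec Q};
  C2 : {vspace bvec Q};
  css_sub : (C2 <= C1)%VS }.

Definition logicalX (K : css_code) : pred (bvec Q) :=
  [pred x | (x \in C1 K) && (x \notin C2 K)].

Definition logicalZ (K : css_code) : pred (bvec Q) :=
  [pred z | (z \in dual (C2 K)) && (z \notin dual (C1 K))].

(* K is an [[n, k, d]] code. *)
Definition css_params (K : css_code) (n k d : nat) :=
  [/\ #|Q| = n, (\dim (C1 K) - \dim (C2 K))%N = k &
      exists dx dz, [/\ is_min_weight (logicalX K) dx,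
                        is_min_weight (logicalZ K) dz & d = minn dx dz]].

Definition X_self_orthogonal (K : css_code) := self_orthogonal (C2 K).

Lemma dotDl x y c : dot (x + y) c = dot x c + dot y c.
Proof.
by rewrite /dot -big_split; apply: eq_bigr => q _ /=; rewrite ffunE mulrDl.
Qed.

Lemma dotZl (a : 'F_2) x c : dot (a *: x) c = a * dot x c.
Proof.
by rewrite /dot big_distrr; apply: eq_bigr => q _ /=; rewrite ffunE -mulrA.
Qed.

Lemma dotC x y : dot x y = dot y x.
Proof. by apply: eq_bigr => q _; rewrite mulrC. Qed.

Lemma dot0l c : dot 0 c = 0.
Proof. by rewrite /dot big1 // => q _; rewrite ffunE mul0r. Qed.

Lemma dot_span (s : seq (bvec Q)) c :
  (forall x, x \in s -> dot x c = 0) ->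
  forall x, x \in <<s>>%VS -> dot x c = 0.
Proof.
move=> H x /(@coord_span _ _ _ (in_tuple s)) ->.
elim/big_rec: _ => [|i y _ IH]; first exact: dot0l.
by rewrite dotDl dotZl IH H ?mulr0 ?addr0 // mem_nth.
Qed.

Lemma dualP (C : {vspace bvec Q}) x :
  reflect (forall c, c \in C -> dot x c = 0) (x \in dual C).
Proof.
apply: (iffP idP) => [xC c cC | H].
  apply: (dot_span _ xC) => y; rewrite mem_enum inE => /forallP/(_ c).
  by rewrite cC => /eqP.
apply: memv_span; rewrite mem_enum inE; apply/forallP => c.
by apply/implyP => cC; rewrite H.
Qed.

End Codes.

Section LocalGeometry.
Variables Q Q' : finType.

Definition restrict (f : Q' -> Q) (x : bvec Q) : bvec Q' := [ffun q => x (f q)].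

Definition punctures_to (f : Q' -> Q)
    (C : {vspace bvec Q}) (C' : {vspace bvec Q'}) :=
  forall y, y \in C' <-> exists2 x, x \in C & restrict f x = y.

Definition shortens_to (A : {set Q}) (f : Q' -> Q)
    (C : {vspace bvec Q}) (C' : {vspace bvec Q'}) :=
  forall y, y \in C' <->
    exists x, [/\ x \in C, supp x \subset A & restrict f x = y].

(* f identifies the qubits of K' with the subset A of those of K. *)
Definition has_local_geometry (K : css_code Q) (K' : css_code Q') :=
  exists (A : {set Q}) (f : Q' -> Q),
    [/\ injective f, [set f q | q in Q'] = A,
        punctures_to f (C2 K) (C2 K') /\ punctures_to f (C1 K) (C1 K') &
        shortens_to A f (dual (C1 K)) (dual (C1 K')) /\
        shortens_to A f (dual (C2 K)) (dual (C2 K'))].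

End LocalGeometry.

Section Quantum.
Variables (R : realType) (Q : finType).

(* (C^2)^{(x) Q}: amplitudes in the computational basis |x>, x in F_2^Q. *)
Notation state := {ffun bvec Q -> R[i]}.

Definition ket (x : bvec Q) : state := [ffun y => (y == x)%:R].

Definition pauliX (c : bvec Q) (psi : state) : state := [ffun x : bvec Q => psi (x + c)].

Definition pauliZ (c : bvec Q) (psi : state) : state :=
  [ffun x : bvec Q => (-1) ^+ (dot c x : 'F_2) * psi x].

Definition codespace (K : css_code Q) (psi : state) :=
  (forall c, c \in C2 K -> pauliX c psi = psi) /\
  (forall c, c \in dual (C1 K) -> pauliZ c psi = psi).

(* The action of the tensor product of the single-qubit gates U q. *)
Definition tensor_gate (U : Q -> 'M[R[i]]_2) (psi : state) : state :=
  [ffun x : bvec Q => \sum_(y : bvec Q) (\prod_q U q (x q) (y q)) * psi y].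

(* Unnormalised logical basis states. *)
Definition ket0L (K : css_code Q) : state := \sum_(c | c \in C2 K) ket c.
Definition ket1L (K : css_code Q) (u : bvec Q) : state :=
  \sum_(c | c \in C2 K) ket (c + u).

(* For K encoding one logical qubit; ket1L K u then does not depend on the
   choice of u in C1 \ C2. *)
Definition transversal_S (K : css_code Q) :=
  exists (U : Q -> 'M[R[i]]_2) (phase : R[i]),
    [/\ forall q, U q \is unitarymx,
        `|phase| = 1,
        forall psi, codespace K psi -> codespace K (tensor_gate U psi) &
        forall u, logicalX K u ->
          tensor_gate U (ket0L K) = phase *: ket0L K /\
          tensor_gate U (ket1L K u) = (phase * 'i) *: ket1L K u].

End Quantum.

(* (x, y) lies in P_{a,b} = {a, a+1} x {b, b+1}, where p = (a, b). *)
Definition in_face (p : int * int) (x y : nat) : bool :=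
  ((x%:Z == p.1) || (x%:Z == p.1 + 1)) && ((y%:Z == p.2) || (y%:Z == p.2 + 1)).

(* The (a, b) with a + b odd, 0 <= a <= d - 2 and -1 <= b <= d - 1. *)
Definition X_faces (d : nat) : seq (int * int) :=
  [seq p : int * int <- [seq (a%:Z, b%:Z - 1) | a <- iota 0 d.-1, b <- iota 0 d.+1]
         | odd (absz (p.1 + p.2))].

(* The (a, b) with a + b even, -1 <= a <= d - 1 and 0 <= b <= d - 2. *)
Definition Z_faces (d : nat) : seq (int * int) :=
  [seq p : int * int <- [seq (a%:Z - 1, b%:Z) | a <- iota 0 d.+1, b <- iota 0 d.-1]
         | ~~ odd (absz (p.1 + p.2))].

Section RotatedSurface.
Variable d : nat.
Notation grid := ('I_d * 'I_d)%type.

Definition face_check (p : int * int) : bvec grid :=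
  indicator (fun q : grid => in_face p q.1 q.2).

Definition surf_X : {vspace bvec grid} := <<map face_check (X_faces d)>>%VS.
Definition surf_Z : {vspace bvec grid} := <<map face_check (Z_faces d)>>%VS.

Definition on_edge (a : int) (x : nat) : bool := (x%:Z == a) || (x%:Z == a + 1).

Lemma dot_face p r : dot (face_check p) (face_check r) =
  (\sum_(x < d) (on_edge p.1 x && on_edge r.1 x)%:R) *
  (\sum_(y < d) (on_edge p.2 y && on_edge r.2 y)%:R).
Proof.
rewrite /dot big_distrl /=.
under [RHS]eq_bigr => x _ do rewrite big_distrr /=.
rewrite pair_bigA /=; apply: eq_bigr => -[x y] _ /=.
rewrite !ffunE /= /in_face -/(on_edge _ x) -/(on_edge _ y).
rewrite -!natrM !mulnb; congr (_%:R); congr nat_of_bool.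
by rewrite -!andbA; congr (_ && _); rewrite andbCA.
Qed.

Lemma edge_sum_same (a : nat) : (a.+1 < d)%N ->
  \sum_(x < d) (on_edge a x && on_edge a x)%:R = 0 :> bit.
Proof.
move=> ad; have a0d : (a < d)%N by lia.
rewrite (bigD1 (Ordinal a0d)) //= (bigD1 (Ordinal ad)) /=; last first.
  by rewrite -val_eqE /=; lia.
rewrite big1 ?addr0.
  have -> : on_edge a a by rewrite /on_edge; lia.
  have -> : on_edge a a.+1 by rewrite /on_edge; lia.
  by apply/val_inj.
move=> x; rewrite -!val_eqE /= => H.
have -> // : on_edge a x = false.
by apply/negbTE; move: H; rewrite /on_edge; lia.
Qed.

Lemma edge_sum_far (a b : int) : (1 < absz (a - b)%R)%N ->
  \sum_(x < d) (on_edge a x && on_edge b x)%:R = 0 :> bit.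
Proof.
move=> ab; rewrite big1 // => x _.
have -> // : on_edge a x && on_edge b x = false.
by apply/negbTE; rewrite /on_edge; lia.
Qed.

Lemma surf_XZ p r : p \in X_faces d -> r \in Z_faces d ->
  dot (face_check p) (face_check r) = 0.
Proof.
rewrite !mem_filter => /andP[po /allpairsPdep[a [b [aI bI ep]]]].
move=> /andP[re /allpairsPdep[a' [b' [aI' bI' er]]]].
move: aI bI aI' bI'; rewrite !mem_iota => aI bI aI' bI'.
rewrite dot_face; subst p r; move: po re => /= po re.
case: (eqVneq (a%:Z) (a'%:Z - 1)) => [<-|na].
  by rewrite edge_sum_same ?mul0r //; lia.
case: (eqVneq (b%:Z - 1) b'%:Z) => [->|nb].
  by rewrite edge_sum_same ?mulr0 //; lia.
case: (ltnP 1 (absz (a%:Z - (a'%:Z - 1))%R)) => [/edge_sum_far ->|fa].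
  by rewrite mul0r.
by rewrite [X in _ * X]edge_sum_far ?mulr0 //; lia.
Qed.

Lemma surf_sub : (surf_X <= dual surf_Z)%VS.
Proof.
apply/subvP => x xX; apply/dualP => z zZ.
apply: (dot_span _ xX) => _ /mapP[p pX ->].
rewrite dotC; apply: (dot_span _ zZ) => _ /mapP[r rZ ->].
by rewrite dotC; exact: surf_XZ.
Qed.

(* C1 is the dual of the span of the Z-stabilizer generators. *)
Definition rotated_surface : css_code grid := CSS surf_sub.

End RotatedSurface.

(* Layers are numbered from 0 at the bottom; layer l carries distance 1 for
   l = 0, and the layers 2i - 1 and 2i carry the distance 2i + 1. *)
Definition layer_dist (l : nat) : nat := (uphalf l).*2.+1.

(* The data qubits (layer, x, y); for odd d the top layer is d - 1, of
   distance d. *)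
Definition qubit3D (d : nat) : finType :=
  {p : 'I_d * 'I_d * 'I_d |
    (p.1.2 < layer_dist p.1.1)%N && (p.2 < layer_dist p.1.1)%N}.

Section Layout.
Variable d : nat.

Definition layer (q : qubit3D d) : nat := (val q).1.1.
Definition xpos (q : qubit3D d) : nat := (val q).1.2.
Definition ypos (q : qubit3D d) : nat := (val q).2.

(* The odd distances 3, 5, ..., d; distance j sits on the layers j - 2 (lower
   copy) and j - 1 (upper copy). *)
Definition distances : seq nat := [seq j <- iota 3 (d - 2) | odd j].

Definition double_check (j : nat) (p : int * int) : bvec (qubit3D d) :=
  indicator (fun q => ((layer q == j - 2) || (layer q == j - 1))%N &&
                      in_face p (xpos q) (ypos q)).

(* The layer j - 3 is the top layer of the group below distance j. *)
Definition connecting_check (j : nat) : bvec (qubit3D d) :=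
  indicator (fun q => ((layer q == j - 2) || (layer q == j - 3))%N).

Definition X_checks3D : seq (bvec (qubit3D d)) :=
  [seq double_check j p | j <- distances, p <- X_faces j] ++
  [seq connecting_check j | j <- distances].

Definition has_3D_layout (K : css_code (qubit3D d)) :=
  C2 K = <<X_checks3D>>%VS.

End Layout.

(* Main.v *)
Require Import Defs.
From HB Require Import structures.
From mathcomp Require Import all_boot all_order all_algebra.
From mathcomp Require Import reals complex.
From mathcomp Require Import zify.
Set Implicit Arguments.
Unset Strict Implicit.
Unset Printing Implicit Defensive.
Import Order.TTheory GRing.Theory Num.Theory.
Local Open Scope ring_scope.

(* Let C2 be the span of the X-checks and C1 = C2 + <1>, where 1 is the all-ones
   vector. All X-checks have even weight and are pairwise orthogonal, so C2 is
   self-orthogonal, and since the number of qubits is odd 1 is not in C2.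

   For weights g with g_q^2 = -1, x |-> prod_q g_q^(x_q) is multiplicative on
   orthogonal pairs. With g = i on the even layers and -i on the odd ones it is 1
   on all X-checks and i on 1, so diag(1, g_q) on each qubit q is a logical S.
   With g = 2 in F_5 it is 2^wt, hence determines the weight modulo 4: it is 1 on
   the double checks and -1 on the connecting checks. Take for v the last
   connecting check, and generate C_e by the double checks and the sums of v with
   the connecting checks.

   On the top layer the code punctures to the surface code; this needs that the
   dual of the Z-faces is spanned by the X-faces and 1, which follows by clearing
   the columns one by one with X-faces. The shortening rule is dual to the
   puncturing rule.

   The d rows of the top layer are disjoint logical Z-operators, so d_x >= d and
   d_z <= d. For d_z >= d, the connecting checks force the layers paired by them
   to have equal parity in a logical Z-operator z, and the double checks force
   the columns of a pair of copies to have equal parity. *)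

(** * Binary codes and quadratic phases *)

Lemma bit_cases (a : bit) : a = 0 \/ a = 1.
Proof. by case: a => [[|[|m]] lt_m] //; [left | right]; apply/val_inj. Qed.

Lemma add_bit_eq0 (a b : bit) : (a + b == 0) = (a == b).
Proof. by case: (bit_cases a) (bit_cases b) => -> [] ->. Qed.

Lemma bit_even n : ~~ odd n -> n%:R = 0 :> bit.
Proof.
move=> en; rewrite -(odd_double_half n) (negbTE en) add0n -muln2 natrM.
by rewrite (_ : 2%:R = 0 :> bit) ?mulr0 //; apply/val_inj.
Qed.

Lemma natr_bit n : n%:R = (odd n)%:R :> bit.
Proof.
case: (boolP (odd n)) => [on|/bit_even //].
by rewrite -(subnK (odd_gt0 on)) natrD bit_even ?add0r // oddB ?odd_gt0 ?on.
Qed.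

Section Vectors.
Variable Q : finType.
Implicit Types x y z : bvec Q.

Lemma addbvv x : x + x = 0.
Proof. by apply/ffunP => q; rewrite !ffunE; apply/eqP; rewrite add_bit_eq0. Qed.

Lemma addbvK x y : x + y + y = x.
Proof. by rewrite -addrA addbvv addr0. Qed.

Lemma dotDr x y z : dot z (x + y) = dot z x + dot z y.
Proof. by rewrite dotC dotDl !(dotC _ z). Qed.

Lemma scale_bit (a : 'F_2) x : a *: x = 0 \/ a *: x = x.
Proof.
by case: (bit_cases a) => ->; [left; rewrite scale0r|right; rewrite scale1r].
Qed.

(** Coefficients are 0 or 1, so the span is reached from 0 by adding generators one at a time.
    Keeping [y] in the span lets the step use orthogonality of [x] and [y]. *)
Lemma span_bit_ind (s : seq (bvec Q)) (P : bvec Q -> Prop) :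
  P 0 ->
  (forall x y, x \in s -> y \in <<s>>%VS -> P y -> P (x + y)) ->
  forall x, x \in <<s>>%VS -> P x.
Proof.
move=> P0 PD x /(@coord_span _ _ _ (in_tuple s)) ->.
set t := (X in P X); suff [] : t \in <<s>>%VS /\ P t by [].
rewrite {}/t; elim/big_rec: _ => [|i y _ [ys Py]]; first by rewrite mem0v.
have si : s`_i \in s by apply: mem_nth.
case: (scale_bit (coord (in_tuple s) i x) s`_i) => -> //=.
  by rewrite add0r.
by split; [rewrite memvD // memv_span | exact: PD].
Qed.

Lemma dot_span2 (s : seq (bvec Q)) :
  {in s &, forall x y, dot x y = 0} ->
  {in <<s>>%VS &, forall x y, dot x y = 0}.
Proof.
move=> s0 x y xs ys; apply: (dot_span _ xs) => u us.
by rewrite dotC; apply: (dot_span _ ys) => v vs; exact: s0.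
Qed.

Lemma memv_add_line (C : {vspace bvec Q}) u x :
  reflect (x \in C \/ x + u \in C) (x \in C + <[u]>)%VS.
Proof.
apply: (iffP memv_addP) => [[c cC [_ /vlineP[a ->] ->]]|[xC|xuC]].
- by case: (scale_bit a u) => ->; [left; rewrite addr0|right; rewrite addbvK].
- by exists x => //; exists 0; rewrite ?mem0v ?addr0.
- by exists (x + u) => //; exists u; rewrite ?memv_line ?addbvK.
Qed.

(** For C1 = C2 + <1> this makes the logical Z-operators the vectors of odd weight in the dual of
    C2. *)
Lemma dual_add_line (C : {vspace bvec Q}) u z :
  (z \in dual (C + <[u]>)) = (z \in dual C) && (dot z u == 0).
Proof.
apply/dualP/andP => [zCu|[/dualP zC /eqP zu] c /memv_add_line[cC|cuC]].
- split; last by apply/eqP/zCu/memv_add_line; right; rewrite addbvv mem0v.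
  by apply/dualP => c cC; apply/zCu/memv_add_line; left.
- exact: zC.
- by rewrite -(addbvK c u) dotDr zC ?zu ?addr0.
Qed.

Lemma dot_indicator (P P' : pred Q) :
  dot (indicator P) (indicator P') = \sum_q (P q && P' q)%:R.
Proof. by apply: eq_bigr => q _; rewrite !ffunE -natrM mulnb. Qed.

Lemma dot_ones x : dot x (indicator predT) = \sum_q x q.
Proof. by apply: eq_bigr => q _; rewrite ffunE mulr1. Qed.

Lemma dot_ones_wt x : dot x (indicator predT) = (wt x)%:R.
Proof.
rewrite dot_ones /wt -sum1_card natr_sum [RHS]big_mkcond; apply: eq_bigr => q _.
by rewrite inE; case: (bit_cases (x q)) => ->.
Qed.

Lemma exists_min_weight (P : pred (bvec Q)) x :
  P x -> exists w, is_min_weight P w.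
Proof.
move=> Px; pose T := [pred w | [exists y, P y && (wt y == w)]].
have : exists w, T w by exists (wt x); apply/existsP; exists x; rewrite Px /=.
case/ex_minnP => w /existsP[y /andP[Py /eqP yw]] w_min; exists w.
by split=> [|z Pz]; [exists y | apply/w_min/existsP; exists z; rewrite Pz /=].
Qed.

(* A function [g] with [g q ^ 2 = -1] turns the diagonal gate
   [\bigotimes_q diag(1, g q)] into a quadratic character of F_2^Q. *)
Section Phase.
Variables (F : comNzRingType) (g : Q -> F).
Hypothesis g2 : forall q, g q * g q = -1.

Definition phase x : F := \prod_q (if x q == 0 then 1 else g q).

Lemma sign_bitD (a b : 'F_2) : (-1) ^+ (a + b)%R = (-1) ^+ a * (-1) ^+ b :> F.
Proof.
by case: (bit_cases a) (bit_cases b) => -> [] -> /=;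
  rewrite ?mulr1 ?mul1r ?mulrNN ?mulr1.
Qed.

(** The products can differ only where [x] and [y] are both 1: there the sum contributes 1 and the
    two phases contribute -1. The parity of the number of such places is [dot x y]. *)
Lemma phaseD x y :
  phase (x + y) = phase x * phase y * (-1) ^+ (dot x y : 'F_2).
Proof.
rewrite /dot (big_morph (fun a : 'F_2 => (-1) ^+ a : F) sign_bitD (erefl _)).
rewrite /phase -!big_split; apply: eq_bigr => q _ /=; rewrite ffunE.
case: (bit_cases (x q)) (bit_cases (y q)) => -> [] -> /=;
  by rewrite ?g2 ?mulrNN ?mulr1 ?mul1r.
Qed.

Lemma phaseD_orthogonal x y : dot x y = 0 -> phase (x + y) = phase x * phase y.
Proof. by move=> xy; rewrite phaseD xy mulr1. Qed.

Lemma phase0 : phase 0 = 1.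
Proof. by rewrite /phase big1 // => q _; rewrite ffunE eqxx. Qed.

Lemma phase_span1 (s : seq (bvec Q)) :
  {in s &, forall x y, dot x y = 0} -> {in s, forall x, phase x = 1} ->
  {in <<s>>%VS, forall x, phase x = 1}.
Proof.
move=> s0 s1; apply: span_bit_ind => [|x y xs ys py]; first exact: phase0.
rewrite phaseD_orthogonal ?py ?s1 ?mulr1 //.
by rewrite (dot_span2 s0) // memv_span.
Qed.

End Phase.

Lemma phase_const (F : comNzRingType) (a : F) x :
  phase (fun=> a) x = a ^+ wt x.
Proof.
rewrite /wt -prodr_const big_mkcond; apply: eq_bigr => q _.
by rewrite inE; case: eqP.
Qed.

End Vectors.

(* Weights modulo 4 are read off the phase of the constant 2, a square root of
   -1 in F_5. *)
Lemma two_expF5 n : ((2%:R : 'F_5) ^+ n == 1) = (4 %| n)%N.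
Proof.
have e4 : (2%:R : 'F_5) ^+ 4 = 1 by apply/val_inj.
rewrite {1}(divn_eq n 4) exprD mulnC exprM e4 expr1n mul1r /dvdn.
have : (n %% 4 < 4)%N by rewrite ltn_pmod.
by case: (n %% 4)%N => [|[|[|[|k]]]].
Qed.

Lemma two_expF5N n : (2%:R : 'F_5) ^+ n = -1 -> n = 2 %[mod 4].
Proof.
have e4 : (2%:R : 'F_5) ^+ 4 = 1 by apply/val_inj.
rewrite {1}(divn_eq n 4) exprD mulnC exprM e4 expr1n mul1r.
have : (n %% 4 < 4)%N by rewrite ltn_pmod.
by case: (n %% 4)%N => [|[|[|[|k]]]].
Qed.

(** * Puncturing, shortening and duality *)

Section Restriction.
Variables (Q Q' : finType) (f : Q' -> Q).
Hypothesis f_inj : injective f.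

Lemma restrictD x y : Defs.restrict f (x + y) = Defs.restrict f x + Defs.restrict f y.
Proof. by apply/ffunP => q; rewrite !ffunE. Qed.

Lemma dot_restrict (x z : bvec Q) : supp z \subset [set f q | q in Q'] ->
  dot z x = dot (Defs.restrict f z) (Defs.restrict f x).
Proof.
move=> zA; rewrite /dot (bigID (mem [set f q | q in Q'])) /= addrC big1 ?add0r.
  rewrite big_imset /=; last by move=> ? ? _ _; apply: f_inj.
  by apply: eq_bigr => q _; rewrite !ffunE.
move=> q qA; suff -> : z q = 0 by rewrite mul0r.
by apply: contraNeq qA => zq; apply: (subsetP zA); rewrite inE.
Qed.

Lemma punctures_to_span (s : seq (bvec Q)) (s' : seq (bvec Q')) :
  {in s, forall x, Defs.restrict f x \in <<s'>>%VS} ->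
  {in s', forall y, exists2 x, x \in s & Defs.restrict f x = y} ->
  punctures_to f <<s>>%VS <<s'>>%VS.
Proof.
move=> ss' s's y; split=> [|[x xs <-]].
  move: y; apply: span_bit_ind.
    by exists 0; rewrite ?mem0v //; apply/ffunP => q; rewrite !ffunE.
  move=> y y' /s's[x xs <-] _ [x' xs' <-].
  by exists (x + x'); rewrite ?restrictD // memvD // memv_span.
move: x xs; apply: span_bit_ind => [|x x' xs _ x's].
  by rewrite (_ : Defs.restrict f 0 = 0) ?mem0v //; apply/ffunP => q; rewrite !ffunE.
by rewrite restrictD memvD // ss'.
Qed.

Lemma punctures_to_add_line (C : {vspace bvec Q}) (C' : {vspace bvec Q'}) u :
  punctures_to f C C' ->
  punctures_to f (C + <[u]>) (C' + <[Defs.restrict f u]>).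
Proof.
move=> CC' y; split=> [/memv_add_line[/CC'[x xC <-]|/CC'[x xC xy]]|[x]].
- by exists x => //; apply/memv_add_line; left.
- exists (x + u); last by rewrite restrictD xy addbvK.
  by apply/memv_add_line; right; rewrite addbvK.
- case/memv_add_line=> xC <-; apply/memv_add_line; [left|right].
    by apply/CC'; exists x.
  by rewrite -restrictD; apply/CC'; exists (x + u).
Qed.

(** A vector supported on the image of [f] pairs with [x] exactly as its restriction pairs with the
    restriction of [x]. *)
Lemma shortens_to_dual (C : {vspace bvec Q}) (C' : {vspace bvec Q'}) :
  punctures_to f C C' ->
  shortens_to [set f q | q in Q'] f (dual C) (dual C').
Proof.
move=> CC' y; split=> [/dualP yC'|[z [/dualP zC zA <-]]]; last first.
  apply/dualP => _ /CC'[x xC <-].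
  by rewrite -dot_restrict // zC.
(* Extension of [y] by zero outside the image of [f]. *)
pose z : bvec Q := [ffun q => if [pick q' | f q' == q] is Some q' then y q' else 0].
have zA : supp z \subset [set f q | q in Q'].
  apply/subsetP => q; rewrite inE ffunE; case: pickP => [q' /eqP <- _|].
    exact: imset_f.
  by rewrite eqxx.
have zy : Defs.restrict f z = y.
  apply/ffunP => q; rewrite !ffunE; case: pickP => [q' /eqP /f_inj -> //|].
  by move/(_ q); rewrite eqxx.
exists z; split=> //; apply/dualP => x xC.
by rewrite dot_restrict // zy; apply: yC'; apply/CC'; exists x.
Qed.

End Restriction.

(** * Transversal phase gates *)

Section DiagonalGate.
Variables (R : realType) (Q : finType) (g : Q -> R[i]).
Notation state := {ffun bvec Q -> R[i]}.

Definition phase_gate (q : Q) : 'M[R[i]]_2 :=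
  \matrix_(a, b) (if a == b then if a == 0 then 1 else g q else 0).

Lemma phase_gateE (psi : state) x :
  tensor_gate phase_gate psi x = phase g x * psi x.
Proof.
rewrite ffunE (bigD1 x) //= [X in _ + X]big1 ?addr0 => [|y /eqP yx].
  suff -> : phase g x = \prod_q phase_gate q (x q) (x q) by [].
  by apply: eq_bigr => q _; rewrite mxE eqxx.
(* A coordinate where [x] and [y] differ contributes an off-diagonal entry 0 to the product. *)
have [q xyq] : exists q, x q != y q.
  apply/existsP; apply: contra_notT yx; rewrite negb_exists => /forallP xy.
  by apply/ffunP => q; apply/esym/eqP; rewrite -[_ == _]negbK xy.
by rewrite (bigD1 q) //= mxE (negbTE xyq) !mul0r.
Qed.

Lemma phase_gate_unitary q : `|g q| = 1 -> phase_gate q \is unitarymx.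
Proof.
move=> gq; apply/unitarymxP/matrixP => a b; rewrite !mxE.
rewrite (bigD1 a) //= big1 => [|c ca]; last first.
  by rewrite !mxE eq_sym (negbTE ca) mul0r.
rewrite !mxE eqxx addr0 [b == a]eq_sym; case: (eqVneq a b) => [->|_]; last first.
  by rewrite conjC0 mulr0.
have unit z : `|z| = 1 :> R[i] -> z * z^* = 1.
  by move=> z1; rewrite -normCK z1 expr1n.
by apply: unit; case: (b == 0); rewrite ?normr1.
Qed.

Variable K : css_code Q.

Lemma ket0LE x : ket0L R K x = (x \in C2 K)%:R.
Proof.
rewrite sum_ffunE; case: (boolP (x \in C2 K)) => xC; last first.
  rewrite big1 // => c cC; rewrite ffunE; case: eqP => // xc.
  by rewrite xc cC in xC.
rewrite (bigD1 x) //= big1 ?addr0 ?ffunE ?eqxx // => c /andP[_ cx].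
by rewrite ffunE eq_sym (negbTE cx).
Qed.

Lemma ket1LE u x : ket1L R K u x = (x + u \in C2 K)%:R.
Proof.
rewrite -ket0LE !sum_ffunE; apply: eq_bigr => c _; rewrite !ffunE.
suff -> : (x == c + u) = (x + u == c) by [].
by apply/eqP/eqP => [->|<-]; rewrite addbvK.
Qed.

(* The C1-part of the code space enters only through the Z-stabilizers
   [c \in C2]: they confine [psi] to the [x] with [dot x c = 0], where the
   phase is unchanged by the X-stabilizer [c]. *)
Lemma phase_gate_transversal_S u :
  (forall q, g q * g q = -1) -> (forall q, `|g q| = 1) ->
  C1 K = (C2 K + <[u]>)%VS -> {in C2 K &, forall x y, dot x y = 0} ->
  {in C2 K, forall c, dot c u = 0} ->
  {in C2 K, forall c, phase g c = 1} -> phase g u = 'i ->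
  transversal_S R K.
Proof.
move=> g2 g1 defC1 C2_0 C2u phC2 phu.
have C2dual c : c \in C2 K -> c \in dual (C1 K).
  move=> cC; rewrite defC1 dual_add_line C2u // eqxx andbT.
  by apply/dualP => c' c'C; exact: C2_0.
exists phase_gate, 1; split=> [q||psi [psiX psiZ]|v].
- exact: phase_gate_unitary.
- exact: normr1.
- split=> c cC; apply/ffunP => x; rewrite [LHS]ffunE !phase_gateE; last first.
    have /ffunP/(_ x) := psiZ c cC; rewrite ffunE => zx.
    by rewrite mulrCA zx.
  have /ffunP/(_ x) := psiX c cC; rewrite ffunE => ->.
  have /ffunP/(_ x) := psiZ c (C2dual c cC); rewrite ffunE => zx.
  by rewrite phaseD // (phC2 _ cC) mulr1 -mulrA dotC zx.
case/andP=> vC1 vC2; rewrite scale1r mul1r.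
have vuC : v + u \in C2 K.
  by move: vC1; rewrite defC1 => /memv_add_line[vC|//]; rewrite vC in vC2.
split; apply/ffunP => x; rewrite phase_gateE.
  by rewrite ket0LE; case: (boolP (x \in _)) => [/phC2 ->|_];
     rewrite ?mul1r ?mulr0.
rewrite ffunE ket1LE; case: (boolP (x + v \in _)) => [xvC|_]; last first.
  by rewrite mulr0 scaler0.
have xuC : x + u \in C2 K.
  by rewrite -(addbvK x v) -addrA memvD.
by rewrite -(addbvK x u) phaseD // (phC2 _ xuC) C2u // mul1r mulr1 phu.
Qed.

End DiagonalGate.

(** * The rotated surface code *)

Section Strips.
Variable d : nat.

(* In the strip x \in {a, a+1} the faces P_{a,b-1} with a + b even cover the
   row y exactly once, namely for the b in {y, y + 1} of the right parity. *)
Lemma strip_sum (a y : nat) (h : nat -> bit) : (y < d)%N ->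
  \sum_(b < d.+1 | ~~ odd (a + b)) h b * (on_edge (b%:Z - 1) y)%:R =
  h (if odd (a + y) then y.+1 else y).
Proof.
move=> yd; set b := (if _ then _ else _).
have bd : (b < d.+1)%N by rewrite /b; case: ifP; lia.
have ab : ~~ odd (a + b).
  by rewrite /b; case: ifP => [|->] // ay; rewrite addnS /= ay.
rewrite (bigD1 (Ordinal bd)) //= big1 => [|c /andP[ac cb]].
  have -> : on_edge (b%:Z - 1) y by rewrite /on_edge /b; case: ifP; lia.
  by rewrite mulr1 addr0.
have -> : on_edge (c%:Z - 1) y = false; last by rewrite mulr0.
apply: contraNF cb => cy; rewrite -val_eqE /=; move: ab ac cy.
rewrite /on_edge /b; case: ifP; lia.
Qed.

Lemma mem_X_faces (a b : nat) : (a.+1 < d)%N -> (b <= d)%N -> ~~ odd (a + b) ->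
  ((a%:Z, b%:Z - 1) : int * int) \in X_faces d.
Proof.
move=> ad bd ab; rewrite mem_filter; apply/andP; split; first by move=> /=; lia.
by apply/allpairsPdep; exists a, b; rewrite !mem_iota /=; split=> //; lia.
Qed.

Lemma X_facesP (p : int * int) : p \in X_faces d ->
  exists a b : nat, [/\ p = (a%:Z, b%:Z - 1), (a.+1 < d)%N, (b <= d)%N & ~~ odd (a + b)].
Proof.
rewrite mem_filter => /andP[ab /allpairsPdep[a [b [ai bi ep]]]].
move: ai bi ab; rewrite ep !mem_iota /= => ai bi ab.
by exists a, b; split=> //; lia.
Qed.

Lemma mem_Z_faces (a b : nat) : (a <= d)%N -> (b.+1 < d)%N -> odd (a + b) ->
  ((a%:Z - 1, b%:Z) : int * int) \in Z_faces d.
Proof.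
move=> ad bd ab; rewrite mem_filter; apply/andP; split; first by move=> /=; lia.
by apply/allpairsPdep; exists a, b; rewrite !mem_iota /=; split=> //; lia.
Qed.

Lemma Z_facesP (p : int * int) : p \in Z_faces d ->
  exists2 b : nat, (b.+1 < d)%N & p = (p.1, b%:Z).
Proof.
rewrite mem_filter => /andP[_ /allpairsPdep[a [b [ai bi ->]]]].
by exists b => //; move: bi; rewrite mem_iota; lia.
Qed.

End Strips.

(** * Clearing columns: the dual of the Z-faces *)

Section Surface.
Variable d : nat.
Notation grid := ('I_d * 'I_d)%type.
Notation ones := (indicator predT : bvec grid).
Implicit Type x : bvec grid.

Definition strip (a : nat) (g : nat -> bit) : bvec grid :=
  [ffun q : grid => (on_edge a q.1)%:R * g q.2].

(** The X-faces of the strip partition its rows into pairs y, y + 1 with a + y odd and single rows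
    at the boundary, so a [g] constant on these pairs is a combination of faces. *)
Lemma strip_surf_X a g : (a.+1 < d)%N ->
  (forall y, (y.+1 < d)%N -> odd (a + y) -> g y = g y.+1) ->
  strip a g \in surf_X d.
Proof.
(* The face P_{a,b-1} gets the value of [g] on its row b; for b = d that row is off the grid, and
   row d - 1 is used. *)
move=> ad gy; pose h b := if (b < d)%N then g b else g b.-1.
have -> : strip a g =
    \sum_(b < d.+1 | ~~ odd (a + b)) h b *: face_check d (a%:Z, b%:Z - 1).
  apply/ffunP => -[x y]; rewrite sum_ffunE ffunE /=.
  have E (b : nat) : (h b *: face_check d (a%:Z, b%:Z - 1)) (x, y) =
      (on_edge a x)%:R * (h b * (on_edge (b%:Z - 1) y)%:R).
    by rewrite !ffunE /in_face -mulnb natrM; exact: mulrCA.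
  under eq_bigr do rewrite E.
  rewrite -big_distrr strip_sum //=; congr (_ * _).
  case: ifP => ay; rewrite /h; last by rewrite ltn_ord.
  by case: ltnP => [yd|//]; rewrite gy.
apply: rpred_sum => b ab; rewrite rpredZ // memv_span //.
by apply/map_f/mem_X_faces => //; rewrite -ltnS.
Qed.

Definition zero_below k (x : bvec grid) := forall q : grid, (q.1 < k)%N -> x q = 0.

Definition entry (x : bvec grid) (i j : nat) : bit :=
  if insub i is Some i' then if insub j is Some j' then x (i', j') else 0 else 0.

Lemma entryE x (q : grid) : entry x q.1 q.2 = x q.
Proof. by rewrite /entry !valK; case: q. Qed.

Lemma dot_face_entry x (p : int * int) (k b : nat) :
  (k < d)%N -> (b.+1 < d)%N -> on_edge p.1 k -> p.2 = b ->
  (forall q : grid, on_edge p.1 q.1 -> q.1 != k :> nat -> x q = 0) ->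
  dot x (face_check d p) = entry x k b + entry x k b.+1.
Proof.
move=> kd bd pk pb x0; have b0d : (b < d)%N by lia.
pose q0 : grid := (Ordinal kd, Ordinal b0d); pose q1 : grid := (Ordinal kd, Ordinal bd).
rewrite /dot (bigD1 q0) //= (bigD1 q1) /=; last first.
  by rewrite xpair_eqE -!val_eqE /=; lia.
rewrite big1 ?addr0 => [|q /andP[qq0 qq1]].
  rewrite !ffunE -[x q0]entryE -[x q1]entryE /in_face /= pb.
  rewrite -!/(on_edge _ k) pk eqxx (_ : b.+1%:Z == b%:Z + 1); last by lia.
  by rewrite orbT !mulr1.
rewrite ffunE; case: (boolP (on_edge p.1 q.1)) => pq; last first.
  by rewrite /in_face -/(on_edge _ _) (negbTE pq) mulr0.
case: (eqVneq (q.1 : nat) k) => [qk|/(x0 q pq) ->]; last by rewrite mul0r.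
suff -> : in_face p q.1 q.2 = false by rewrite mulr0.
apply: contraNF qq0 => /andP[_]; rewrite pb.
move: qq1; rewrite (surjective_pairing q) !xpair_eqE -!val_eqE /= qk eqxx /=.
by lia.
Qed.

(** The Z-face on columns k - 1 and k sees only column k, since column k - 1 is zero, or off the
    grid when k = 0. *)
Lemma dual_Z_entry x k b : x \in dual (surf_Z d) -> zero_below k x ->
  (k < d)%N -> (b.+1 < d)%N -> odd (k + b) -> entry x k b = entry x k b.+1.
Proof.
move=> /dualP xZ xk kd bd kb; apply/eqP; rewrite -add_bit_eq0; apply/eqP.
rewrite -(@dot_face_entry x (k%:Z - 1, b%:Z)) //=.
- by apply/xZ/memv_span/map_f/mem_Z_faces => //; exact: ltnW.
- by rewrite /on_edge; lia.
- by move=> q qk nqk; apply: xk; move: qk nqk; rewrite /on_edge; lia.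
Qed.

Lemma clear_column x k : x \in dual (surf_Z d) -> zero_below k x -> (k.+1 < d)%N ->
  exists2 s, s \in surf_X d & zero_below k.+1 (x + s).
Proof.
(* The strip repeats column k of [x] in columns k and k + 1. The Z-faces impose on column k exactly
   the condition that puts this strip in [surf_X]. *)
move=> xZ xk kd; exists (strip k (entry x k)).
  apply: strip_surf_X => // y yd ky; apply: dual_Z_entry => //; exact: ltnW.
move=> q; rewrite ltnS leq_eqVlt => qk; rewrite !ffunE.
case: (eqVneq (q.1 : nat) k) => [qk1|nqk].
  by rewrite -qk1 entryE /on_edge eqxx mul1r; apply/eqP; rewrite add_bit_eq0.
rewrite xk ?add0r; last by rewrite (negbTE nqk) in qk.
suff -> : on_edge k q.1 = false by rewrite mul0r.
by move: qk nqk; rewrite /on_edge; lia.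
Qed.

Lemma clear_columns x k : x \in dual (surf_Z d) -> (k < d)%N ->
  exists2 s, s \in surf_X d & zero_below k (x + s).
Proof.
move=> xZ; elim: k => [|k IHk] kd; first by exists 0; rewrite ?mem0v.
have [s sX xs] := IHk (ltnW kd).
have [|t tX xst] := clear_column _ xs kd.
  by rewrite memvD // (subvP (surf_sub d)).
by exists (s + t); rewrite ?memvD // addrA.
Qed.

Hypothesis odd_d : odd d.

Definition last_column : bvec grid := indicator (fun q : grid => q.1 == d.-1 :> nat).

Lemma zero_below_last x : x \in dual (surf_Z d) -> zero_below d.-1 x ->
  x = 0 \/ x = last_column.
Proof.
move=> xZ x0; have d1d : (d.-1 < d)%N by lia.
have step b : (b.+1 < d)%N -> entry x d.-1 b = entry x d.-1 b.+1.
  move=> bd; case: (boolP (odd (d.-1 + b))) => [|even_b]; first exact: dual_Z_entry.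
  apply/eqP; rewrite -add_bit_eq0; apply/eqP.
  (* The boundary Z-face P_{d-1,b} meets the grid only in the last column and supplies the parity
     that [dual_Z_entry] leaves out. *)
  rewrite -(@dot_face_entry x (d%:Z - 1, b%:Z)) //=.
  - apply: (dualP _ _ xZ); apply/memv_span/map_f/mem_Z_faces => //; lia.
  - by rewrite /on_edge; lia.
  - move=> q; have := ltn_ord q.1; rewrite /on_edge; lia.
have const b : (b < d)%N -> entry x d.-1 b = entry x d.-1 0.
  by elim: b => // b IHb bd; rewrite -step // IHb // ltnW.
have xE q : x q = entry x d.-1 0 * last_column q.
  rewrite ffunE; case: eqP => [qd|/eqP qd]; last first.
    by rewrite mulr0 x0 // ltn_neqAle qd -ltnS (ltn_predK d1d) ltn_ord.
  by rewrite mulr1 -(const q.2) // -qd entryE.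
case: (bit_cases (entry x d.-1 0)) xE => -> xE; [left|right]; apply/ffunP => q.
  by rewrite xE mul0r ffunE.
by rewrite xE mul1r.
Qed.

Lemma dual_Z_cases x : x \in dual (surf_Z d) ->
  x \in surf_X d \/ x + last_column \in surf_X d.
Proof.
move=> xZ; have [|s sX xs0] := @clear_columns x d.-1 xZ; first by lia.
have xsZ : x + s \in dual (surf_Z d) by rewrite memvD // (subvP (surf_sub d)).
case: (zero_below_last xsZ xs0) => [xs|<-]; [left|right].
  by rewrite -(addbvK x s) xs add0r.
by rewrite addrA addbvv add0r.
Qed.

Lemma dot_face_ones p : dot (face_check d p) ones =
  (\sum_(x < d) (on_edge p.1 x)%:R) * (\sum_(y < d) (on_edge p.2 y)%:R).
Proof.
rewrite dot_ones big_distrl /=.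
under [RHS]eq_bigr => x _ do rewrite big_distrr /=.
rewrite pair_bigA /=; apply: eq_bigr => -[x y] _ /=.
by rewrite ffunE -natrM mulnb.
Qed.

Lemma edge_even (a : nat) : (a.+1 < d)%N -> \sum_(x < d) (on_edge a x)%:R = 0 :> bit.
Proof.
by move=> ad; rewrite -[RHS](edge_sum_same ad); apply: eq_bigr => x _; rewrite andbb.
Qed.

Lemma X_face_even p : p \in X_faces d -> dot (face_check d p) ones = 0.
Proof.
by case/X_facesP => a [b [-> ad _ _]]; rewrite dot_face_ones edge_even ?mul0r.
Qed.

Lemma ones_notin_surf_X : ones \notin surf_X d.
Proof.
apply/negP => /(dot_span (c := ones)) ones0.
have : dot ones ones = 0.
  by apply: ones0 => _ /mapP[p pX ->]; exact: X_face_even.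
rewrite dot_ones; under eq_bigr do rewrite ffunE.
by rewrite sumr_const card_prod card_ord natr_bit oddM odd_d.
Qed.

Lemma ones_dual_Z : ones \in dual (surf_Z d).
Proof.
apply/dualP => z zZ; rewrite dotC; apply: (dot_span _ zZ) => _ /mapP[p pZ ->].
have [b bd ->] := Z_facesP pZ.
by rewrite dot_face_ones [X in _ * X]edge_even ?mulr0.
Qed.

Lemma dual_surf_Z : dual (surf_Z d) = (surf_X d + <[ones]>)%VS.
Proof.
apply/vspaceP => x; apply/idP/memv_add_line => [xZ|]; last first.
  case=> /(subvP (surf_sub d)) // xZ.
  by rewrite -(addbvK x ones) memvD // ones_dual_Z.
(* Not being in [surf_X], [ones] is congruent to [last_column] modulo [surf_X] and can replace it as
   coset representative. *)
case: (dual_Z_cases ones_dual_Z) => oX; first by case/negP: ones_notin_surf_X.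
case: (dual_Z_cases xZ) => xX; [by left|right].
have -> : x + ones = (x + last_column) + (ones + last_column).
  by rewrite [ones + _]addrC addrA addbvK.
exact: memvD.
Qed.

End Surface.

(** * The layered code *)

Lemma layer_dist_le d l : odd d -> (l < d)%N -> (layer_dist l <= d)%N.
Proof. by rewrite /layer_dist; lia. Qed.

Lemma mem_distances d j : (j \in distances d) = [&& odd j, 2 < j & j <= d]%N.
Proof. by rewrite mem_filter mem_iota; case: (odd j) => //=; lia. Qed.

Lemma layer_dist_pair j l : odd j -> (2 < j)%N ->
  ((l == j - 2) || (l == j - 1))%N -> layer_dist l = j.
Proof. by rewrite /layer_dist; lia. Qed.

Lemma layer_dist_below j : odd j -> (2 < j)%N -> layer_dist (j - 3) = (j - 2)%N.
Proof. by rewrite /layer_dist; lia. Qed.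

Section Block3D.
Variable d : nat.
Hypothesis odd_d : odd d.
Notation qubit := (qubit3D d).
Notation ones := (indicator predT : bvec qubit).

Lemma big_qubit3D (T : Type) (idx : T) (op : Monoid.com_law idx)
    (F : nat -> nat -> nat -> T) :
  \big[op/idx]_(q : qubit) F (layer q) (xpos q) (ypos q) =
  \big[op/idx]_(l < d) \big[op/idx]_(x < layer_dist l)
    \big[op/idx]_(y < layer_dist l) F l x y.
Proof.
pose P := [pred p : 'I_d * 'I_d * 'I_d |
    (p.1.2 < layer_dist p.1.1)%N && (p.2 < layer_dist p.1.1)%N].
transitivity (\big[op/idx]_(p | P p) F p.1.1 p.1.2 p.2).
  by rewrite (@big_sub _ _ op _ P (fun p => F p.1.1 p.1.2 p.2)).
transitivity (\big[op/idx]_(l < d) \big[op/idx]_(x < d | x < layer_dist l)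
    \big[op/idx]_(y < d | y < layer_dist l) F l x y)%N.
  by rewrite pair_big_dep pair_big_dep /=.
apply: eq_bigr => l _; have ld := layer_dist_le odd_d (ltn_ord l).
rewrite (big_ord_widen d (fun x => \big[op/idx]_(y < layer_dist l) F l x y)) //.
by apply: eq_bigr => x _; rewrite (big_ord_widen d (fun y => F l x y)).
Qed.

(** Patterns are predicates on natural-number coordinates, so that layers of different sizes are
    treated alike and weights, inner products and phases split layer by layer. *)
Definition layer_weight (S : nat -> nat -> nat -> bool) (l : nat) : nat :=
  \sum_(x < layer_dist l) \sum_(y < layer_dist l) S l x y.

Implicit Types S T : nat -> nat -> nat -> bool.
Notation pattern S := (indicator (fun q : qubit => S (layer q) (xpos q) (ypos q))).

Lemma sum_pattern S : (\sum_(q : qubit) S (layer q) (xpos q) (ypos q) =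
  \sum_(l < d) layer_weight S l)%N.
Proof. exact: (big_qubit3D addn (fun l x y => S l x y)). Qed.

Lemma wt_pattern S : wt (pattern S) = (\sum_(l < d) layer_weight S l)%N.
Proof.
rewrite -sum_pattern /wt -sum1_card big_mkcond; apply: eq_bigr => q _.
by rewrite inE ffunE; case: (S _ _ _).
Qed.

Lemma dot_patterns S T : dot (pattern S) (pattern T) =
  \sum_(l < d) (layer_weight (fun l x y => S l x y && T l x y) l)%:R.
Proof.
rewrite dot_indicator -!natr_sum; congr (_%:R).
exact: (sum_pattern (fun l x y => S l x y && T l x y)).
Qed.

Lemma phase_pattern (F : comNzRingType) (g : nat -> F) S :
  phase (fun q : qubit => g (layer q)) (pattern S) =
  \prod_(l < d) g l ^+ layer_weight S l.
Proof.
transitivity (\prod_(q : qubit) g (layer q) ^+ S (layer q) (xpos q) (ypos q)).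
  by apply: eq_bigr => q _; rewrite ffunE; case: (S _ _ _).
rewrite (big_qubit3D *%R (fun l x y => g l ^+ S l x y)); apply: eq_bigr => l _.
rewrite -prodrXr; apply: eq_bigr => x _; exact: prodrXr.
Qed.

Lemma layer_weight0 S l : (forall x y, S l x y = false) -> layer_weight S l = 0%N.
Proof. by move=> S0; rewrite /layer_weight; do 2!(apply: big1 => ? _); rewrite S0. Qed.

Lemma layer_weight_full S l : (forall x y, S l x y) ->
  layer_weight S l = (layer_dist l * layer_dist l)%N.
Proof.
move=> S1; rewrite /layer_weight.
under eq_bigr do under eq_bigr do rewrite S1.
by rewrite !sum_nat_const !card_ord muln1.
Qed.

Lemma eq_layer_weight S T l : (forall x y, S l x y = T l x y) ->
  layer_weight S l = layer_weight T l.
Proof. by move=> ST; do 2!(apply: eq_bigr => ? _); rewrite ST. Qed.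

Lemma big_two (M : Type) (idx : M) (op : Monoid.com_law idx) (G : nat -> M) a b :
  (a < d)%N -> (b < d)%N -> a != b ->
  (forall l, l != a -> l != b -> G l = idx) ->
  \big[op/idx]_(l < d) G l = op (G a) (G b).
Proof.
move=> ad bd ab G0; rewrite (bigD1 (Ordinal ad)) //= (bigD1 (Ordinal bd)) /=.
  rewrite big1 ?Monoid.mulm1 // => l; rewrite -!val_eqE /= => /andP[la lb].
  exact: G0.
by rewrite -val_eqE eq_sym.
Qed.

Definition face_weight j p : nat := \sum_(x < j) \sum_(y < j) in_face p x y.

Lemma face_weight_even j p : p \in X_faces j -> ~~ odd (face_weight j p).
Proof.
move=> /X_face_even; rewrite dot_ones => w0; apply/negP => w1.
have : (face_weight j p)%:R = 0 :> bit.
  rewrite -{}[RHS]w0 natr_sum; under eq_bigr do rewrite natr_sum.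
  by rewrite pair_bigA; apply: eq_bigr => q _; rewrite ffunE.
by rewrite natr_bit w1.
Qed.

Notation in_pair j l := ((l == j - 2) || (l == j - 1))%N.

Lemma layer_weight_double j p (T : nat -> bool) l : odd j -> (2 < j)%N ->
  layer_weight (fun l x y => (in_pair j l && in_face p x y) && T l) l =
  (if in_pair j l && T l then face_weight j p else 0)%N.
Proof.
move=> oj j2; case: (boolP (in_pair j l)) => jl /=; last first.
  by apply: layer_weight0 => x y /=; rewrite (negbTE jl).
case: (boolP (T l)) => Tl; last by apply: layer_weight0 => x y; rewrite (negbTE Tl) andbF.
rewrite /layer_weight (layer_dist_pair oj j2 jl).
by do 2!(apply: eq_bigr => ? _); rewrite jl Tl andbT.
Qed.

(** In every layer a double check is empty or an X-face, of even weight, hence orthogonal to any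
    union of full layers. Connecting checks and the all-ones vector are such unions. *)
Lemma double_dot_layers j p (T : nat -> bool) : j \in distances d -> p \in X_faces j ->
  dot (double_check d j p) (indicator (fun q : qubit => T (layer q))) = 0.
Proof.
rewrite mem_distances => /and3P[oj j2 jd] pX.
rewrite (@dot_patterns (fun l x y => in_pair j l && in_face p x y) (fun l _ _ => T l)).
apply: big1 => l _; rewrite layer_weight_double //; case: ifP => // _.
by rewrite bit_even // face_weight_even.
Qed.

(** Different distances occupy disjoint layers; for equal distances the two copies contribute equal
    terms, which cancel over F_2. *)
Lemma double_dot_double j j' p p' : j \in distances d -> j' \in distances d ->
  dot (double_check d j p) (double_check d j' p') = 0.
Proof.
rewrite !mem_distances => /and3P[oj j2 jd] /and3P[oj' j2' jd'].
rewrite (@dot_patterns (fun l x y => in_pair j l && in_face p x y)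
                       (fun l x y => in_pair j' l && in_face p' x y)).
set S := (X in layer_weight X); have S0 l : ~~ (in_pair j l && in_pair j' l) ->
    (layer_weight S l)%:R = 0 :> bit.
  move=> nl; rewrite layer_weight0 // => x y; rewrite /S.
  by apply: contraNF nl => /andP[/andP[-> _] /andP[-> _]].
case: (eqVneq j j') => jj'; last first.
  by apply: big1 => l _; apply: S0; lia.
rewrite (@big_two _ _ +%R (fun l => (layer_weight S l)%:R) (j - 2) (j - 1)) /=; try lia.
  rewrite /layer_weight !(layer_dist_pair oj j2) ?eqxx ?orbT //.
  have -> : S (j - 2)%N = S (j - 1)%N by rewrite /S -jj' !eqxx !orbT.
  by apply/eqP; rewrite add_bit_eq0.
by move=> l l1 l2; apply: S0; rewrite -jj' (negbTE l1) (negbTE l2).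
Qed.

Notation in_conn j l := ((l == j - 2) || (l == j - 3))%N.

Lemma layer_weight_conn j : odd j -> (2 < j)%N ->
  layer_weight (fun l _ _ => in_conn j l) (j - 2) = (j * j)%N /\
  layer_weight (fun l _ _ => in_conn j l) (j - 3) = ((j - 2) * (j - 2))%N.
Proof.
move=> oj j2; rewrite !layer_weight_full ?eqxx ?orbT //.
by rewrite layer_dist_below // (@layer_dist_pair j) ?eqxx.
Qed.

Lemma conn_dot_ones j : j \in distances d -> dot (connecting_check d j) ones = 0.
Proof.
rewrite mem_distances => /and3P[oj j2 jd].
rewrite (@dot_patterns (fun l _ _ => in_conn j l) (fun _ _ _ => true)).
set S := (X in layer_weight X).
have [w1 w2] := layer_weight_conn oj j2.
have SE l : layer_weight S l = layer_weight (fun l _ _ => in_conn j l) l.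
  by apply: eq_layer_weight => x y; rewrite /S andbT.
rewrite (@big_two _ _ +%R (fun l => (layer_weight S l)%:R) (j - 2) (j - 3)) /=; try lia.
  by rewrite !SE w1 w2 -natrD bit_even // oddD !oddM oddB ?oj //; lia.
by move=> l l1 l2; rewrite layer_weight0 // => x y; rewrite /S (negbTE l1) (negbTE l2).
Qed.

Lemma conn_dot_conn j j' : j \in distances d -> j' \in distances d ->
  dot (connecting_check d j) (connecting_check d j') = 0.
Proof.
move=> jd j'd; case: (eqVneq j j') => [<-|jj'].
  rewrite -[RHS](conn_dot_ones jd) dot_ones; apply: eq_bigr => q _.
  by rewrite ffunE -natrM mulnb andbb.
move: jd j'd; rewrite !mem_distances => /and3P[oj j2 jd] /and3P[oj' j2' jd'].
rewrite dot_indicator big1 // => q _; case: andP => // -[lj lj']; exfalso; lia.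
Qed.

Lemma X_checks3DP c : reflect
  ((exists j p, [/\ j \in distances d, p \in X_faces j & c = double_check d j p]) \/
   (exists2 j, j \in distances d & c = connecting_check d j))
  (c \in X_checks3D d).
Proof.
rewrite mem_cat; apply: (iffP orP) => [[/allpairsPdep[j [p [jd pX ->]]]|/mapP[j jd ->]]|].
- by left; exists j, p.
- by right; exists j.
case=> [[j [p [jd pX ->]]]|[j jd ->]]; [left|right; exact: map_f].
by apply/allpairsPdep; exists j, p.
Qed.

Lemma X_checks_orthogonal : {in X_checks3D d &, forall x y, dot x y = 0}.
Proof.
move=> x y /X_checks3DP[[j [p [jd pX ->]]]|[j jd ->]]
  /X_checks3DP[[j' [p' [jd' pX' ->]]]|[j' jd' ->]].
- exact: double_dot_double.
- exact: (double_dot_layers (fun l => in_conn j' l)).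
- by rewrite dotC; apply: (double_dot_layers (fun l => in_conn j l)).
- exact: conn_dot_conn.
Qed.

Lemma X_checks_ones : {in X_checks3D d, forall x, dot x ones = 0}.
Proof.
move=> x /X_checks3DP[[j [p [jd pX ->]]]|[j jd ->]]; last exact: conn_dot_ones.
exact: (double_dot_layers xpredT).
Qed.

Lemma ones_dot_ones : dot ones ones = 1.
Proof.
rewrite (@dot_patterns (fun _ _ _ => true) (fun _ _ _ => true)).
under eq_bigr => l _ do rewrite layer_weight_full // natr_bit oddM /layer_dist /= odd_double.
by rewrite sumr_const card_ord [LHS]natr_bit odd_d.
Qed.

Section LayerPhase.
Variables (F : comNzRingType) (g : nat -> F).
Hypothesis g2 : forall l, g l * g l = -1.

Lemma expr_even_phase l n : ~~ odd n -> g l ^+ n = (-1) ^+ n./2.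
Proof.
by move=> en; rewrite -{1}(even_halfK en) -mul2n exprM expr2 g2.
Qed.

Lemma expr_odd_square l n : odd n -> g l ^+ (n * n) = g l.
Proof.
(* For n = 2k + 1 the square is 4k(k + 1) + 1, and [g l] has fourth power 1. *)
move=> on; have -> : (n * n = 4 * (n./2 * n./2.+1) + 1)%N.
  by rewrite -{1 2}(odd_double_half n) on; lia.
have g4 : g l ^+ 4 = 1 by rewrite (exprM _ 2 2) (expr2 (g l)) g2 sqrrN expr1n.
by rewrite exprD exprM g4 expr1n mul1r.
Qed.

(** Each copy contributes -1 to the power w/2, with w the even weight of the face, whatever [g] is
    on that layer; the two copies together give 1. *)
Lemma phase_double j p : j \in distances d -> p \in X_faces j ->
  phase (fun q : qubit => g (layer q)) (double_check d j p) = 1.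
Proof.
rewrite mem_distances => /and3P[oj j2 jd] pX.
rewrite (@phase_pattern _ g (fun l x y => in_pair j l && in_face p x y)).
set S := (X in layer_weight X).
have SE l : layer_weight S l = if in_pair j l then face_weight j p else 0%N.
  rewrite -[in_pair j l]andbT -(layer_weight_double p xpredT) //.
  by apply: eq_layer_weight => x y; rewrite andbT.
rewrite (@big_two _ _ *%R (fun l => g l ^+ layer_weight S l) (j - 2) (j - 1)) /=; try lia.
  by rewrite !SE !eqxx !orbT !expr_even_phase ?face_weight_even // -exprMn mulrNN mulr1 expr1n.
by move=> l l1 l2; rewrite SE (negbTE l1) (negbTE l2).
Qed.

(** Both layers have an odd square number of qubits, which leaves one factor of [g] per layer. *)
Lemma phase_conn j : j \in distances d ->
  phase (fun q : qubit => g (layer q)) (connecting_check d j) = g (j - 2) * g (j - 3).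
Proof.
rewrite mem_distances => /and3P[oj j2 jd].
rewrite (@phase_pattern _ g (fun l _ _ => in_conn j l)).
have [w1 w2] := layer_weight_conn oj j2.
set S := (X in layer_weight X).
rewrite (@big_two _ _ *%R (fun l => g l ^+ layer_weight S l) (j - 2) (j - 3)) /=; try lia.
  by rewrite w1 w2 !expr_odd_square //; lia.
by move=> l l1 l2; rewrite layer_weight0 // => x y; rewrite /S (negbTE l1) (negbTE l2).
Qed.

Lemma phase_ones :
  phase (fun q : qubit => g (layer q)) ones = \prod_(l < d) g l.
Proof.
rewrite (@phase_pattern _ g (fun _ _ _ => true)); apply: eq_bigr => l _.
by rewrite layer_weight_full // expr_odd_square //= odd_double.
Qed.

End LayerPhase.

End Block3D.

(** * The code: size, weights modulo 4 and the logical S *)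

Section Code3D.
Variable d : nat.
Notation ones Q := (indicator predT : bvec Q).

Definition code3D : css_code (qubit3D d) :=
  CSS (addvSl <<X_checks3D d>>%VS <[ones (qubit3D d)]>%VS).

Hypothesis odd_d : odd d.
Notation qubit := (qubit3D d).

Lemma C2_orthogonal : {in C2 code3D &, forall x y, dot x y = 0}.
Proof. exact: (dot_span2 (X_checks_orthogonal odd_d)). Qed.

Lemma C2_ones : {in C2 code3D, forall x, dot x (ones qubit) = 0}.
Proof. by move=> x; apply: dot_span; exact: (X_checks_ones odd_d). Qed.

Lemma ones_notin_C2 : ones qubit \notin C2 code3D.
Proof.
by apply/negP => /C2_ones; rewrite ones_dot_ones // => /eqP.
Qed.

Lemma dim_code3D : (\dim (C1 code3D) - \dim (C2 code3D) = 1)%N.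
Proof.
rewrite dimv_disjoint_sum; last first.
  apply/eqP; rewrite -subv0; apply/subvP => x; rewrite memv_cap => /andP[xC].
  case/vlineP => a ex; move: xC; rewrite ex.
  case: (scale_bit a (ones qubit)) => ->; first by rewrite !mem0v.
  by move=> oC; case/negP: ones_notin_C2.
rewrite addKn dim_vline; case: eqP => // o0.
by case/negP: ones_notin_C2; rewrite o0 mem0v.
Qed.

Lemma card_qubit3D : #|qubit| = (d * (d + 1) * (d + 2) %/ 3 - 1)%N.
Proof.
have -> : #|qubit| = (\sum_(l < d) layer_dist l * layer_dist l)%N.
  rewrite -sum1_card (big_qubit3D odd_d addn (fun _ _ _ => 1%N)).
  by apply: eq_bigr => l _; rewrite !sum_nat_const !card_ord muln1.
have -> : d = d./2.*2.+1 by rewrite -{1}(odd_double_half d) odd_d.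
move: d./2 => m.
(* Multiplying by 3 and adding 1 avoids division and truncated subtraction; the induction step adds
   the two layers of distance 2m + 3. *)
have E : (3 * (\sum_(l < m.*2.+1) layer_dist l * layer_dist l + 1) =
    m.*2.+1 * (m.*2.+1 + 1) * (m.*2.+1 + 2))%N.
  elim: m => [|m IHm]; first by rewrite big_ord_recl big_ord0.
  rewrite doubleS !big_ord_recr /= !mulnDr -/(layer_dist _).
  move: IHm; rewrite big_ord_recr /= !mulnDr.
  have -> : layer_dist m.*2 = m.*2.+1 by rewrite /layer_dist; lia.
  have -> : layer_dist m.*2.+1 = m.*2.+3 by rewrite /layer_dist; lia.
  have -> : layer_dist m.*2.+2 = m.*2.+3 by rewrite /layer_dist; lia.
  by lia.
by rewrite -E mulKn // addnK.
Qed.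

Lemma divisible_weights : (3 <= d)%N ->
  exists (Ce : {vspace bvec qubit}) (v : bvec qubit),
    [/\ (Ce + <[v]> = C2 code3D)%VS, directv (Ce + <[v]>),
        forall c, c \in Ce -> (4 %| wt c)%N & wt v = 2 %[mod 4]].
Proof.
move=> d3; pose v := connecting_check d d.
have dd : d \in distances d by rewrite mem_distances odd_d d3 leqnn.
(* Connecting checks have phase -1 in F_5, so adding [v] brings them back to 1; for j = d the sum is
   0. *)
pose s := [seq double_check d j p | j <- distances d, p <- X_faces j] ++
  [seq connecting_check d j + v | j <- distances d].
pose two (l : nat) : 'F_5 := 2%:R.
have two2 l : two l * two l = -1 by apply/val_inj.
have phase_wt (c : bvec qubit) : phase (fun q : qubit => two (layer q)) c = 2%:R ^+ wt c.
  exact: phase_const.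
have vC : v \in C2 code3D by apply/memv_span/X_checks3DP; right; exists d.
have phv : phase (fun q : qubit => two (layer q)) v = -1.
  by rewrite (phase_conn odd_d two2) //; exact: (two2 0%N).
have sC : {subset s <= C2 code3D}.
  move=> x; rewrite mem_cat => /orP[/allpairsPdep[j [p [jd pX ->]]]|/mapP[j jd ->]].
    by apply/memv_span/X_checks3DP; left; exists j, p.
  by rewrite memvD //; apply/memv_span/X_checks3DP; right; exists j.
have phs : {in <<s>>%VS, forall c, (4 %| wt c)%N}.
  move=> c cs; rewrite -two_expF5 -phase_wt; apply/eqP.
  move: c cs; apply: phase_span1 => // [x y xs ys|x].
    by apply: C2_orthogonal; apply: sC.
  rewrite mem_cat => /orP[/allpairsPdep[j [p [jd pX ->]]]|/mapP[j jd ->]].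
    exact: (phase_double odd_d two2).
  rewrite phaseD_orthogonal //; last exact: (conn_dot_conn odd_d).
  by rewrite (phase_conn odd_d two2) // phv (two2 0%N : two _ * two _ = -1) mulrNN mulr1.
exists <<s>>%VS, v; split=> //.
- apply/eqP; rewrite eqEsubv subv_add -memvE vC andbT; apply/andP; split.
    by apply/span_subvP.
  apply/span_subvP => x /X_checks3DP[[j [p [jd pX ->]]]|[j jd ->]]; apply/memv_add_line.
    left; apply: memv_span; rewrite mem_cat; apply/orP; left.
    by apply/allpairsPdep; exists j, p.
  right; apply: memv_span; rewrite mem_cat; apply/orP; right.
  exact: (map_f (fun j => connecting_check d j + v)).
- apply/directv_addP/eqP; rewrite -subv0; apply/subvP => x; rewrite memv_cap => /andP[xs].
  case/vlineP => a ex; move: xs; rewrite ex.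
  case: (scale_bit a v) => ->; first by rewrite !mem0v.
  (* [v] has phase -1, so its weight is not divisible by four. *)
  by move=> /phs; rewrite -two_expF5 -phase_wt phv.
- by apply: two_expF5N; rewrite -phase_wt.
Qed.

Lemma transversal_S3D (R : realType) : transversal_S R code3D.
Proof.
(* A connecting check joins an odd layer to the even one below, so the opposite signs multiply to 1.
   Over all layers the pairs cancel too and, d being odd, one factor i remains. *)
pose g (l : nat) : R[i] := if odd l then - 'i else 'i.
have g2 l : g l * g l = -1 by rewrite /g; case: odd; rewrite ?mulrNN -expr2 sqrCi.
apply: (@phase_gate_transversal_S R qubit (fun q => g (layer q)) code3D (ones qubit)) => //.
- by move=> q; rewrite /g; case: odd; rewrite ?normrN normCi.
- exact: C2_orthogonal.
- exact: C2_ones.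
- apply: phase_span1 => //; first exact: (X_checks_orthogonal odd_d).
  move=> x /X_checks3DP[[j [p [jd pX ->]]]|[j jd ->]].
    exact: (phase_double odd_d g2).
  rewrite (phase_conn odd_d g2) // /g; move: jd; rewrite mem_distances => /and3P[oj j2 _].
  rewrite !oddB ?oj //; last exact: ltnW.
  by rewrite /= mulNr -expr2 sqrCi opprK.
rewrite (phase_ones odd_d g2).
have -> : d = d./2.*2.+1 by rewrite -{1}(odd_double_half d) odd_d.
elim: d./2 => [|m IHm]; first by rewrite big_ord_recl big_ord0 mulr1.
by rewrite doubleS 2!big_ord_recr /= IHm /g /= odd_double /= -mulrA mulNr -expr2 sqrCi opprK mulr1.
Qed.

End Code3D.

(** * Local geometry and distance *)

Section TopLayer.
Variable d : nat.
Hypothesis odd_d : odd d.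
Notation qubit := (qubit3D d).
Notation grid := ('I_d * 'I_d)%type.
Notation ones Q := (indicator predT : bvec Q).

Lemma top_lt : (d.-1 < d)%N.
Proof. by rewrite prednK ?odd_gt0. Qed.

Lemma top_layer_dist : layer_dist d.-1 = d.
Proof. by move: odd_d; rewrite /layer_dist; lia. Qed.

Lemma top_qubit_proof (q : grid) :
  ((q.1 < layer_dist (Ordinal top_lt)) && (q.2 < layer_dist (Ordinal top_lt)))%N.
Proof. by rewrite /= top_layer_dist !ltn_ord. Qed.

Definition top_qubit (q : grid) : qubit :=
  exist _ (Ordinal top_lt, q.1, q.2) (top_qubit_proof q).

Lemma top_qubit_inj : injective top_qubit.
Proof. by move=> [x y] [x' y'] /(congr1 val) /= [-> ->]. Qed.

Lemma restrict_double j p : j \in distances d ->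
  Defs.restrict top_qubit (double_check d j p) =
    if j == d then face_check d p else 0.
Proof.
rewrite mem_distances => /and3P[oj j2 jd]; apply/ffunP => q.
rewrite !ffunE /layer /xpos /ypos /=; case: (eqVneq j d) => jd'; rewrite ?ffunE.
  by rewrite (_ : (d.-1 == j - 2) || (d.-1 == j - 1))%N //; lia.
by rewrite (_ : (d.-1 == j - 2) || (d.-1 == j - 1) = false)%N //; lia.
Qed.

(** Even the highest connecting check, on layers d - 3 and d - 2, stops below the top layer d -
    1. *)
Lemma restrict_conn j : j \in distances d ->
  Defs.restrict top_qubit (connecting_check d j) = 0.
Proof.
rewrite mem_distances => /and3P[oj j2 jd]; apply/ffunP => q.
rewrite !ffunE /layer /=.
by rewrite (_ : (d.-1 == j - 2) || (d.-1 == j - 3) = false)%N //; lia.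
Qed.

Lemma top_punctures_C2 : punctures_to top_qubit (C2 (code3D d)) (surf_X d).
Proof.
apply: punctures_to_span => [x /X_checks3DP[[j [p [jd pX ->]]]|[j jd ->]]|y /mapP[p pX ->]].
- rewrite restrict_double //; case: eqP => [jd'|_]; last exact: mem0v.
  by apply/memv_span/map_f; rewrite -jd'.
- by rewrite restrict_conn // mem0v.
(* The existence of an X-face excludes d = 1. *)
have dd : d \in distances d.
  by have [a [b [_ ad _ _]]] := X_facesP pX; rewrite mem_distances odd_d; lia.
exists (double_check d d p); first by apply/X_checks3DP; left; exists d, p.
by rewrite restrict_double ?eqxx.
Qed.

Lemma local_geometry3D : has_local_geometry (code3D d) (rotated_surface d).
Proof.
have pC1 : punctures_to top_qubit (C1 (code3D d)) (C1 (rotated_surface d)).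
  rewrite /= dual_surf_Z // (_ : ones grid = Defs.restrict top_qubit (ones qubit)).
    exact: punctures_to_add_line top_punctures_C2.
  by apply/ffunP => q; rewrite !ffunE.
exists [set top_qubit q | q in predT], top_qubit; split=> //.
- exact: top_qubit_inj.
- by split=> //; exact: top_punctures_C2.
- split; apply: shortens_to_dual => //; first exact: top_qubit_inj.
    exact: top_qubit_inj.
  exact: top_punctures_C2.
Qed.

(** The support carries at least d distinct labels. Both distance bounds use this, with rows, layers
    or columns as labels. *)
Lemma labels_le_wt (x : bvec qubit) (label : qubit -> nat) :
  (forall v, (v < d)%N -> exists2 q, x q != 0 & label q = v) -> (d <= wt x)%N.
Proof.
move=> labelP; have := @uniq_leq_size _ (iota 0 d) [seq label q | q <- enum (supp x)].
rewrite size_iota size_map -cardE iota_uniq; apply=> // v.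
rewrite mem_iota => /labelP[q xq <-].
by rewrite map_f // mem_enum inE.
Qed.

Definition top_row (r : nat) : bvec qubit :=
  indicator (fun q : qubit => (layer q == d.-1) && (ypos q == r)).

Lemma sum_eq_ord n r : (r < n)%N -> (\sum_(y < n) (y == r :> nat) = 1)%N.
Proof.
move=> rn; rewrite (bigD1 (Ordinal rn)) //= eqxx big1 // => y.
by rewrite -val_eqE => /negbTE /= ->.
Qed.

Lemma wt_top_row r : (r < d)%N -> wt (top_row r) = d.
Proof.
move=> rd; rewrite (wt_pattern odd_d (fun l x y => (l == d.-1) && (y == r))).
rewrite (bigD1 (Ordinal top_lt)) //= big1 ?addn0 => [|l]; last first.
  by rewrite -val_eqE /= => /negbTE ld; apply: layer_weight0 => x y; rewrite ld.
rewrite /layer_weight top_layer_dist eqxx /=.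
by rewrite sum_eq_ord // sum_nat_const card_ord muln1.
Qed.

Lemma top_row_ones r : (r < d)%N -> dot (top_row r) (ones qubit) = 1.
Proof.
by move=> rd; rewrite dot_ones_wt wt_top_row // natr_bit odd_d.
Qed.

(** Only restrictions to the top layer matter, and an X-face meets a row in 0 or 2 qubits because
    both its columns lie in the grid. *)
Lemma top_row_dual r : top_row r \in dual (C2 (code3D d)).
Proof.
apply/dualP => c cC; rewrite (dot_restrict top_qubit_inj); last first.
  apply/subsetP => q; rewrite inE ffunE; case: andP => [[/eqP lq _] _|]; last by rewrite eqxx.
  apply/imsetP; exists ((val q).1.2, (val q).2) => //.
  apply/val_inj => /=; case: q lq => [[[l x] y] qP] /=; rewrite /layer /= => lq.
  by congr (_, _, _); apply/val_inj.
have -> : Defs.restrict top_qubit (top_row r) = indicator (fun q : grid => q.2 == r :> nat).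
  by apply/ffunP => q; rewrite !ffunE /layer /ypos /= eqxx.
have cX : Defs.restrict top_qubit c \in surf_X d by apply/top_punctures_C2; exists c.
rewrite dotC; apply: (dot_span _ cX) => _ /mapP[p /X_facesP[a [b [-> ad _ _]]] ->].
rewrite dot_indicator.
transitivity ((\sum_(x < d) (on_edge a x)%:R) *
    (\sum_(y < d) (on_edge (b%:Z - 1) y && (y == r :> nat))%:R) : bit).
  rewrite big_distrl /=; under [RHS]eq_bigr => x _ do rewrite big_distrr /=.
  rewrite pair_bigA /=; apply: eq_bigr => q _.
  by rewrite -natrM mulnb andbA.
by rewrite edge_even ?mul0r.
Qed.

(** A logical X-operator is the all-ones vector plus an X-stabilizer, so it pairs to 1 with each of
    the d disjoint top rows and meets them all. *)
Lemma logicalX_wt x : logicalX (code3D d) x -> (d <= wt x)%N.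
Proof.
case/andP=> /memv_add_line[-> //|xC] _.
apply: (@labels_le_wt x (@ypos d)) => r rd.
have : dot (top_row r) x = 1.
  rewrite -(addbvK x (ones qubit)) dotDr top_row_ones //.
  by rewrite (dualP _ _ (top_row_dual r)) ?add0r.
move=> x1; have [q /andP[qr xq]|q0] := pickP (fun q => (ypos q == r) && (x q != 0)).
  by exists q => //; apply/eqP.
move/eqP: x1; rewrite /dot big1 // => q _; rewrite ffunE.
have := q0 q; case: eqP => [_ /= /negbFE/eqP ->|_ _]; first by rewrite mulr0.
by rewrite andbF mul0r.
Qed.

Lemma top_row_logicalZ : logicalZ (code3D d) (top_row 0).
Proof.
have d0 : (0 < d)%N by apply: odd_gt0.
by rewrite /logicalZ /= top_row_dual dual_add_line negb_and top_row_ones // orbT.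
Qed.

End TopLayer.

(** * Lower bound on the weight of logical Z-operators *)

Section ZDistance.
Variable d : nat.
Hypothesis odd_d : odd d.
Notation qubit := (qubit3D d).
Notation ones Q := (indicator predT : bvec Q).
Variable z : bvec qubit.
Hypothesis z_dual : z \in dual (C2 (code3D d)).

Notation in_pair j l := ((l == j - 2) || (l == j - 1))%N.

Definition column_sum j a : bit :=
  \sum_(q : qubit | in_pair j (layer q) && (xpos q == a)) z q.

Definition layer_sum l : bit := \sum_(q : qubit | layer q == l) z q.

Lemma xpos_lt (q : qubit) : (xpos q < layer_dist (layer q))%N.
Proof. by case/andP: (valP q). Qed.

Lemma ypos_lt (q : qubit) : (ypos q < layer_dist (layer q))%N.
Proof. by case/andP: (valP q). Qed.

Lemma sum_fiber (P : pred qubit) (f : qubit -> nat) n :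
  (forall q, P q -> (f q < n)%N) ->
  \sum_(q | P q) z q = \sum_(v < n) \sum_(q | P q && (f q == v)) z q.
Proof.
move=> fn; rewrite (exchange_big_dep P) /=; last by move=> v q _ /andP[].
apply: eq_bigr => q Pq; rewrite (big_pred1 (Ordinal (fn q Pq))) // => v.
by rewrite Pq /= -val_eqE eq_sym.
Qed.

Lemma column_sum_step j a : j \in distances d -> (a.+1 < j)%N ->
  column_sum j a = column_sum j a.+1.
Proof.
move=> jd aj; have := jd; rewrite mem_distances => /and3P[oj j2 _].
pose s : bvec qubit := indicator (fun q => in_pair j (layer q) && on_edge a (xpos q)).
have sC : s \in C2 (code3D d).
  (* By [strip_sum] with constant weight 1, the double checks of a strip add up to its full
     indicator in both copies. *)
  have -> : s = \sum_(b < j.+1 | ~~ odd (a + b)) double_check d j (a%:Z, b%:Z - 1).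
    apply/ffunP => q; rewrite sum_ffunE ffunE.
    case: (boolP (in_pair j (layer q))) => jq /=; last first.
      by rewrite big1 // => b _; rewrite ffunE (negbTE jq).
    have yj : (ypos q < j)%N by rewrite -(layer_dist_pair oj j2 jq) ypos_lt.
    have E (b : nat) : double_check d j (a%:Z, b%:Z - 1) q =
        (on_edge a (xpos q))%:R * (1 * (on_edge (b%:Z - 1) (ypos q))%:R).
      by rewrite ffunE jq /= /in_face -mulnb natrM mul1r.
    under eq_bigr do rewrite E.
    by rewrite -big_distrr (strip_sum _ (fun=> 1)) //= mulr1.
  apply: rpred_sum => b ab; apply/memv_span/X_checks3DP; left.
  by exists j, (a%:Z, b%:Z - 1); split=> //; apply: mem_X_faces => //; rewrite -ltnS.
have := dualP _ _ z_dual _ sC.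
suff -> : dot z s = column_sum j a + column_sum j a.+1.
  by move/eqP; rewrite add_bit_eq0 => /eqP.
rewrite /column_sum [X in X + _]big_mkcond [X in _ + X]big_mkcond -big_split.
apply: eq_bigr => q _; rewrite ffunE /on_edge.
case: (in_pair j (layer q)); rewrite /= ?mulr0 ?addr0 //.
case: (eqVneq (xpos q) a) => [->|xa] /=.
  by rewrite eqxx (_ : (a == a.+1) = false) ?addr0 ?mulr1 //; lia.
rewrite add0r (_ : (_ || _) = (xpos q == a.+1)); last by lia.
by case: eqP; rewrite ?mulr1 ?mulr0.
Qed.

(** The columns have equal parity and their number is odd, so each has the parity of the two layers
    together. *)
Lemma column_sum_const j a : j \in distances d -> (a < j)%N ->
  column_sum j a = layer_sum (j - 2)%N + layer_sum (j - 1)%N.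
Proof.
move=> jd aj; have := jd; rewrite mem_distances => /and3P[oj j2 _].
have const b : (b < j)%N -> column_sum j b = column_sum j 0.
  by elim: b => // b IHb bj; rewrite -column_sum_step // IHb // ltnW.
transitivity (\sum_(q | in_pair j (layer q)) z q).
  rewrite (@sum_fiber _ (@xpos d) j) => [|q jq]; last first.
    by rewrite -(layer_dist_pair oj j2 jq) xpos_lt.
  rewrite (eq_bigr (fun=> column_sum j 0)) => [|b _]; last exact: const.
  rewrite sumr_const card_ord const // -mulr_natr (_ : j%:R = 1 :> bit) ?mulr1 //.
  by rewrite natr_bit oj.
rewrite /layer_sum [LHS]big_mkcond [X in X + _]big_mkcond [X in _ + X]big_mkcond -big_split.
apply: eq_bigr => q _ /=; case: (eqVneq (layer q) (j - 2)%N) => [->|_] /=.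
  by rewrite (_ : (j - 2 == j - 1)%N = false) ?addr0 //; lia.
by rewrite add0r.
Qed.

Lemma layer_sum_conn j : j \in distances d -> layer_sum (j - 2)%N = layer_sum (j - 3)%N.
Proof.
move=> jd; have := jd; rewrite mem_distances => /and3P[oj j2 _].
have cC : connecting_check d j \in C2 (code3D d).
  by apply/memv_span/X_checks3DP; right; exists j.
apply/eqP; rewrite -add_bit_eq0 -(dualP _ _ z_dual _ cC); apply/eqP.
rewrite /layer_sum [X in X + _]big_mkcond [X in _ + X]big_mkcond -big_split.
apply: eq_bigr => q _ /=; rewrite ffunE; case: (eqVneq (layer q) (j - 2)%N) => [->|_] /=.
  by rewrite (_ : (j - 2 == j - 3)%N = false) ?addr0 ?mulr1 //; lia.
by rewrite add0r; case: eqP; rewrite ?mulr1 ?mulr0.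
Qed.

Lemma layer_sum_pair k : (k.*2.+2 < d)%N -> layer_sum k.*2.+1 = layer_sum k.*2.
Proof.
move=> kd; have jd : k.*2.+3 \in distances d by rewrite mem_distances /= odd_double.
by have := layer_sum_conn jd; rewrite !subSS !subn0.
Qed.

Hypothesis z_odd : dot z (ones qubit) = 1.

(** Layers 2k and 2k + 1 have equal parity and cancel, so the odd total falls on the top layer, the
    only one without a partner. *)
Lemma layer_sum_top : layer_sum d.-1 = 1.
Proof.
rewrite -z_odd dot_ones (@sum_fiber predT (@layer d) d) => [|q _]; last exact: ltn_ord.
transitivity (\sum_(v < d) layer_sum v); last by apply: eq_bigr.
have E k : (k.*2 < d)%N -> \sum_(v < k.*2.+1) layer_sum v = layer_sum k.*2.
  elim: k => [|k IHk] kd; first by rewrite big_ord_recr big_ord0 /= add0r.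
  rewrite doubleS 2!big_ord_recr /= IHk ?layer_sum_pair //; last by lia.
  rewrite (_ : layer_sum k.*2 + layer_sum k.*2 = 0) ?add0r //.
  by apply/eqP; rewrite add_bit_eq0.
have d_half : d./2.*2.+1 = d by rewrite -[RHS](odd_double_half d) odd_d.
have sumE n : n = d -> \sum_(v < n) layer_sum v = \sum_(v < d) layer_sum v by move=> ->.
rewrite -(sumE _ d_half) E; last by rewrite -[X in (_ < X)%N]d_half.
by congr layer_sum; rewrite -[X in X.-1]d_half.
Qed.

Lemma exists_layer l : layer_sum l = 1 -> exists2 q, z q != 0 & layer q = l.
Proof.
move=> l1; have [q /andP[/eqP ql zq]|q0] := pickP (fun q => (layer q == l) && (z q != 0)).
  by exists q.
move/eqP: l1; rewrite /layer_sum big1 // => q ql.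
by have := q0 q; rewrite ql => /negbFE/eqP.
Qed.

(* Take the lowest odd [j] such that every layer from [j - 1] upwards is odd.
   Then the layers j - 2 and j - 1 have odd total parity, so each of their [j]
   columns meets [z], and so does each of the layers above. *)
Lemma logicalZ_wt : (d <= wt z)%N.
Proof.
(* [T k] stands for j = 2k + 1, whose topmost layer is 2k. *)
pose T k := [forall l : 'I_d, (k.*2 <= l)%N ==> (layer_sum l == 1)].
have Thalf : T d./2.
  apply/forallP => l; apply/implyP => dl.
  have -> : l = d.-1 :> nat by have := ltn_ord l; lia.
  by rewrite layer_sum_top.
have : exists k, T k by exists d./2.
case/ex_minnP => k Tk k_min.
have above l : (k.*2 <= l)%N -> (l < d)%N -> layer_sum l = 1.
  by move=> kl ld; apply/eqP; have /forallP/(_ (Ordinal ld))/implyP := Tk; exact.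
have kd : (k.*2 < d)%N.
  apply: leq_ltn_trans (top_lt odd_d); have : (k <= d./2)%N; last by lia.
  apply: k_min; exact: Thalf.
case: k Tk k_min above kd => [|k] Tk k_min above kd.
  by apply: (@labels_le_wt d z (@layer d)) => v vd; apply/exists_layer/above.
(* If layer 2k + 1 were odd, its partner 2k would be odd too, against minimality. *)
have even_below : layer_sum k.*2.+1 = 0.
  case: (bit_cases (layer_sum k.*2.+1)) => // odd_below.
  suff /k_min : T k by rewrite ltnn.
  apply/forallP => l; apply/implyP => kl; apply/eqP.
  case: (ltnP l k.+1.*2) => [lk|kl']; last exact: above.
  have [->|->] : l = k.*2.+1 :> nat \/ l = k.*2 :> nat by lia.
    exact: odd_below.
  by rewrite -layer_sum_pair // -doubleS.
have jd : k.*2.+3 \in distances d by rewrite mem_distances /= odd_double -doubleS.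
(* The columns of the pair supply the labels below 2k + 3, the layers above it those from 2k + 3 to
   d - 1. *)
pose label (q : qubit) := if (layer q < k.*2.+3)%N then xpos q else layer q.
apply: (@labels_le_wt d z label) => v vd; rewrite /label.
case: (ltnP v k.*2.+3) => vj; last first.
  have [|q zq qv] := @exists_layer v; first by apply: above => //; lia.
  by exists q => //; rewrite qv ltnNge vj.
have c1 : column_sum k.*2.+3 v = 1.
  rewrite column_sum_const // !subSS !subn0 even_below add0r.
  by apply: above; rewrite ?doubleS.
have [q /andP[/andP[jq /eqP qv] zq]|q0] := pickP (fun q : qubit =>
    in_pair k.*2.+3 (layer q) && (xpos q == v) && (z q != 0)).
  by exists q => //; case: ifP => //; lia.
move/eqP: c1; rewrite /column_sum big1 // => q qv.
by have := q0 q; rewrite qv => /negbFE/eqP.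
Qed.

End ZDistance.

Lemma params3D d : odd d ->
  css_params (code3D d) ((d * (d + 1) * (d + 2)) %/ 3 - 1)%N 1 d.
Proof.
move=> odd_d; split; [exact: card_qubit3D|exact: dim_code3D|].
have oX : logicalX (code3D d) (indicator predT).
  rewrite /logicalX /= (ones_notin_C2 odd_d) andbT.
  by apply/memv_add_line; right; rewrite addbvv mem0v.
have [dx minX] := exists_min_weight oX.
(* The bound d_x >= d suffices, since d_z is exactly d. *)
exists dx, d; split=> //.
  split=> [|z].
    exists (top_row d 0); [exact: top_row_logicalZ | exact: wt_top_row (odd_gt0 odd_d)].
  rewrite /logicalZ /= dual_add_line => /andP[zC]; rewrite zC /= => z1.
  apply: logicalZ_wt => //; case: (bit_cases (dot z (indicator predT))) z1 => [->|//].
  by rewrite eqxx.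
have [[x xX <-] _] := minX.
by rewrite (minn_idPr (logicalX_wt odd_d xX)).
Qed.

Theorem mainTheorem4 (R : realType) :
  exists K : forall d : nat, css_code (qubit3D d),
  forall d : nat, odd d ->
  [/\ has_3D_layout (K d) /\ X_self_orthogonal (K d),
      has_local_geometry (K d) (rotated_surface d),
      transversal_S R (K d),
      css_params (K d) ((d * (d + 1) * (d + 2)) %/ 3 - 1)%N 1 d &
      (3 <= d)%N ->
      exists (Ce : {vspace bvec (qubit3D d)}) (v : bvec (qubit3D d)),
        [/\ (Ce + <[v]> = C2 (K d))%VS,
            directv (Ce + <[v]>),
            forall c, c \in Ce -> (4 %| wt c)%N &
            wt v = 2 %[mod 4]]].
Proof.
exists code3D => d odd_d; split.
- split=> //; apply/subvP => x xC; apply/dualP => y yC.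
  exact: (C2_orthogonal odd_d).
- exact: local_geometry3D.
- exact: transversal_S3D.
- exact: params3D.
- exact: divisible_weights.
Qed.
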